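(* Let $N\geq 3$ be an integer. For every integer $k\geq 2$, $$\gamma_N^2\sum_{r=1}^{k-1}\eta_{r,k-r}^2\leq\alpha_k-1.$$
   Context: $(U_k)_{k\ge0}$ are the monic Chebyshev polynomials of the second kind: $U_0(x)=1$, $U_1(x)=x$, $U_{k+1}(x)=xU_k(x)-U_{k-1}(x)$. Put $d_k=U_k(N)$ and $\alpha_k=N\,\frac{U_k'(N)}{U_k(N)}$. For integers $r,s\ge1$ put $\eta_{rs}=\eta_{r,s}=\left(\frac{d_rd_s}{d_{r+s}}\right)^{1/2}$, and $\gamma_N=\left(1+\frac1{N^2}\right)^{1/2}$. *)

(* Defs.v *)
From mathcomp Require Import all_boot all_order all_algebra.

Set Implicit Arguments.
Unset Strict Implicit.
Unset Printing Implicit Defensive.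

Import Order.TTheory GRing.Theory Num.Theory.
Local Open Scope ring_scope.

(* Monic normalisation of the Chebyshev polynomials of the second kind:
   chebU k evaluated at 2 cos t is sin ((k + 1) t) / sin t. *)
Fixpoint chebU (R : nzRingType) (k : nat) : {poly R} :=
  match k with
  | 0 => 1
  | k1.+1 => match k1 with
             | 0 => 'X
             | k2.+1 => 'X * chebU R k1 - chebU R k2
             end
  end.

Definition d_ (R : rcfType) (N k : nat) : R := (chebU R k).[N%:R].

Definition alpha_ (R : rcfType) (N k : nat) : R :=
  N%:R * ((chebU R k)^`().[N%:R] / (chebU R k).[N%:R]).

Definition eta_ (R : rcfType) (N r s : nat) : R :=
  Num.sqrt (d_ R N r * d_ R N s / d_ R N (r + s)).

Definition gamma_ (R : rcfType) (N : nat) : R :=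
  Num.sqrt (1 + 1 / N%:R ^+ 2).

(* Main.v *)
(* Write u_k = U_k(N) and T_k for the sum of u_r u_(k-r) over 0 < r < k.  Since
   U_k' is the convolution of the U_r U_(k-1-r), the recurrence satisfied by
   the derivatives at N reads T_k + U_(k-1)'(N) = N U_k'(N) - u_k.  As
   u_r <= N u_(r-1), one has T_k <= N^2 U_(k-1)'(N), so that
   (1 + 1/N^2) T_k <= N U_k'(N) - u_k; divide by u_k. *)
Require Import Defs.
From mathcomp Require Import all_boot all_order all_algebra.
From mathcomp Require Import zify ring.
Import Order.TTheory GRing.Theory Num.Theory.
Local Open Scope ring_scope.

Local Arguments chebU : simpl never.

Lemma chebUSS (R : nzRingType) k :
  chebU R k.+2 = 'X * chebU R k.+1 - chebU R k.
Proof. by []. Qed.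

Lemma deriv_chebUSS (R : comNzRingType) k :
  (chebU R k.+2)^`()
    = chebU R k.+1 + 'X * (chebU R k.+1)^`() - (chebU R k)^`().
Proof. by rewrite chebUSS derivB derivM derivX mul1r. Qed.

(** Both sides obey the same two-step recurrence; equivalently, differentiate the generating
    function [1 / (1 - x t + t^2)] in [x]. *)
Lemma deriv_chebU (R : comNzRingType) k :
  (chebU R k)^`() = \sum_(r < k) chebU R r * chebU R (k.-1 - r).
Proof.
suff: (chebU R k)^`() = \sum_(r < k) chebU R r * chebU R (k.-1 - r) /\
      (chebU R k.+1)^`() = \sum_(r < k.+1) chebU R r * chebU R (k - r).
  by case.
elim: k => [|k [IHk IHk1]].
  by rewrite big_ord0 big_ord1 derivC derivX mulr1.
split=> //; rewrite deriv_chebUSS IHk IHk1.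
rewrite 2![in RHS]big_ord_recr [in LHS]big_ord_recr.
rewrite /=.
(* For [i < k] the second index is at least 2, so the recurrence applies to that factor; the terms
   at [k] and [k.+1] were split off because there it does not. *)
have -> : \sum_(i < k) chebU R i * chebU R (k.+1 - i)
    = 'X * (\sum_(i < k) chebU R i * chebU R (k - i))
      - \sum_(i < k) chebU R i * chebU R (k.-1 - i).
  rewrite mulr_sumr -sumrB; apply: eq_bigr => i _.
  have [-> ->] : (k.+1 - i = (k.-1 - i).+2 /\ k - i = (k.-1 - i).+1)%N.
    by have := ltn_ord i; lia.
  by rewrite chebUSS; ring.
rewrite subSnn !subnn -[chebU R 0]/1 -[chebU R 1]/'X /=.
ring.
Qed.

Lemma d_0 (R : rcfType) N : d_ R N 0 = 1.
Proof. exact: hornerC. Qed.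

Lemma d_1 (R : rcfType) N : d_ R N 1 = N%:R.
Proof. exact: hornerX. Qed.

Lemma d_SS (R : rcfType) N k :
  d_ R N k.+2 = N%:R * d_ R N k.+1 - d_ R N k.
Proof. by rewrite /d_ chebUSS hornerD hornerN hornerM hornerX. Qed.

(** Positivity and growth are proved together, as the subtraction in the recurrence is controlled by
    growth: u_(k+1) + u_k <= 2 u_(k+1) <= N u_(k+1). *)
Lemma d_gt0_le (R : rcfType) N k : (2 <= N)%N -> 0 < d_ R N k <= d_ R N k.+1.
Proof.
move=> N_ge2; elim: k => [|k /andP[dk_gt0 le_dk]].
  by rewrite d_0 d_1 ltr01 ler1n ltnW.
have dk1_gt0 : 0 < d_ R N k.+1 by apply: lt_le_trans le_dk.
rewrite dk1_gt0 d_SS lerBrDr /=; apply: (le_trans (lerD (lexx _) le_dk)).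
by rewrite -mulr2n -[_ *+ 2]mulr_natl ler_pM2r // ler_nat.
Qed.

Lemma d_gt0 (R : rcfType) N k : (2 <= N)%N -> 0 < d_ R N k.
Proof. by move=> /(d_gt0_le R N k) /andP[]. Qed.

Lemma d_S_le (R : rcfType) N k :
  (2 <= N)%N -> d_ R N k.+1 <= N%:R * d_ R N k.
Proof.
move=> N_ge2; case: k => [|k]; first by rewrite d_0 d_1 mulr1.
by rewrite d_SS gerBl ltW // d_gt0.
Qed.

Lemma horner_deriv_chebU (R : rcfType) N k :
  (chebU R k)^`().[N%:R] = \sum_(r < k) d_ R N r * d_ R N (k.-1 - r).
Proof.
by rewrite deriv_chebU horner_sum; apply: eq_bigr => r _; rewrite hornerM.
Qed.

Lemma sum_dd_eq (R : rcfType) N k :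
  \sum_(r < k.+1) d_ R N r.+1 * d_ R N (k.+1 - r)
    = N%:R * (chebU R k.+2)^`().[N%:R] - d_ R N k.+2
      - (chebU R k.+1)^`().[N%:R].
Proof.
(* The two end terms of this convolution both equal u_(k+2), since u_0 = 1; the interior is the
   wanted sum. *)
have derivE : (chebU R k.+3)^`().[N%:R]
    = \sum_(r < k.+1) d_ R N r.+1 * d_ R N (k.+1 - r) + d_ R N k.+2 *+ 2.
  rewrite horner_deriv_chebU big_ord_recl big_ord_recr /= subn0 subnn d_0.
  ring.
have := congr1 (horner^~ N%:R) (deriv_chebUSS R k.+1).
rewrite hornerD hornerN hornerD hornerM hornerX -/(d_ R N k.+2) derivE => sumE.
by have -> := canRL (addrK _) sumE; ring.
Qed.

Lemma sum_dd_le (R : rcfType) N k : (2 <= N)%N ->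
  \sum_(r < k.+1) d_ R N r.+1 * d_ R N (k.+1 - r)
    <= N%:R ^+ 2 * (chebU R k.+1)^`().[N%:R].
Proof.
move=> N_ge2; rewrite horner_deriv_chebU mulr_sumr; apply: ler_sum => r _.
(* One factor [N] goes to each of the two indices being lowered. *)
rewrite subSn ?leq_ord // expr2 mulrACA.
by apply: ler_pM; rewrite ?d_S_le // ltW ?d_gt0.
Qed.

Theorem lemma3p2 (R : rcfType) (N : nat) (hN : (3 <= N)%N)
    (k : nat) (hk : (2 <= k)%N) :
  gamma_ R N ^+ 2 * (\sum_(1 <= r < k) eta_ R N r (k - r)%N ^+ 2)
    <= alpha_ R N k - 1.
Proof.
have N_ge2 : (2 <= N)%N by apply: ltnW.
case: k hk => [|[|k]] // _.
have N_gt0 : 0 < N%:R :> R by rewrite ltr0n; apply: ltnW.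
have dk_gt0 : 0 < d_ R N k.+2 by apply: d_gt0.
rewrite sqr_sqrtr; last by rewrite addr_ge0 // divr_ge0 // exprn_ge0 // ltW.
rewrite big_add1 big_mkord.
have -> : \sum_(i < k.+1) eta_ R N i.+1 (k.+2 - i.+1) ^+ 2
    = (\sum_(i < k.+1) d_ R N i.+1 * d_ R N (k.+1 - i)) / d_ R N k.+2.
  rewrite mulr_suml; apply: eq_bigr => i _.
  rewrite /eta_ subnKC ?subSS; last by rewrite ltnS ltnW.
  by rewrite sqr_sqrtr // divr_ge0 ?mulr_ge0 // ltW ?d_gt0.
rewrite /alpha_ -/(d_ R N k.+2) mulrA ler_pdivrMr //.
rewrite mulrBl !mul1r -[X in _ <= X - _]mulrA divfK ?gt_eqF //.
(* The right side becomes the sum plus U_(k+1)'(N); cancelling the sum leaves exactly the bound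
   [sum_dd_le] divided by N^2. *)
have /eqP := sum_dd_eq R N k; rewrite eq_sym subr_eq => /eqP ->.
rewrite mulrDl mul1r lerD2l mulrC ler_pdivrMr ?exprn_gt0 //.
by rewrite [X in _ <= X]mulrC sum_dd_le.
Qed.
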